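(* Let $\mathcal{H}$ be a set of sequents and $\Pi\to B$ a sequent, all in the product-free language (built using only $\backslash$, $/$, $\wedge$, $\mathbf{0}$, $\mathbf{1}$). If $\Pi\to B$ is derivable from $\mathcal{H}$ in $\mathbf{L}^{\Lambda}\wedge\mathbf{0}\mathbf{1}$, then $\Pi\to B$ is derivable from $\mathcal{H}$ in $\mathbf{L}^{\Lambda}_{\backslash,/}\wedge\mathbf{0}\mathbf{1}$. Moreover, if $\mathcal{H}$ and $\Pi\to B$ additionally contain no occurrences of $\mathbf{0}$ and $\mathbf{1}$, then $\Pi\to B$ is derivable from $\mathcal{H}$ in $\mathbf{L}^{\Lambda}_{\backslash,/}\wedge$.
   Context: Formulae are built from a countable set of propositional variables and the constants $\mathbf{0}$ and $\mathbf{1}$ using the binary connectives $\cdot$, $\backslash$, $/$, $\wedge$. A sequent is $\Pi \to B$ with $B$ a formula and $\Pi$ a finite, possibly empty, sequence of formulae (empty sequence written $\Lambda$). The calculus $\mathbf{L}^{\Lambda}\wedge\mathbf{0}\mathbf{1}$ has the axioms $A \to A$, $\Gamma,\mathbf{0},\Delta \to C$ and $\Lambda \to \mathbf{1}$, and rules (capital Greek letters denote possibly empty sequences): (Cut) from $\Pi \to A$ and $\Gamma, A, \Delta \to C$ infer $\Gamma,\Pi,\Delta\to C$; ($\backslash L$) from $\Pi\to A$ and $\Gamma,B,\Delta\to C$ infer $\Gamma,\Pi,A\backslash B,\Delta\to C$; ($\backslash R$) from $A,\Pi\to B$ infer $\Pi\to A\backslash B$; ($/ L$) from $\Pi\to A$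 and $\Gamma,B,\Delta\to C$ infer $\Gamma,B/A,\Pi,\Delta\to C$; ($/R$) from $\Pi,A\to B$ infer $\Pi\to B/A$; ($\cdot L$) from $\Gamma,A,B,\Delta\to C$ infer $\Gamma,A\cdot B,\Delta\to C$; ($\cdot R$) from $\Pi\to A$ and $\Delta\to B$ infer $\Pi,\Delta\to A\cdot B$; ($\wedge L$) from $\Gamma,A,\Delta\to C$ infer both $\Gamma,A\wedge B,\Delta\to C$ and $\Gamma,B\wedge A,\Delta\to C$; ($\wedge R$) from $\Pi\to A$ and $\Pi\to B$ infer $\Pi\to A\wedge B$; ($\mathbf{1} L$) from $\Gamma,\Delta\to C$ infer $\Gamma,\mathbf{1},\Delta\to C$. The calculus $\mathbf{L}^{\Lambda}_{\backslash,/}\wedge\mathbf{0}\mathbf{1}$ is obtained (in the product-free language) by removing the rules $\cdot L$ and $\cdot R$; the calculus $\mathbf{L}^{\Lambda}_{\backslash,/}\wedge$ (in the language of $\backslash,/,\wedge$ only) is obtained by further removing the axioms $\Gamma,\mathbf{0},\Delta\to C$, $\Lambda\to\mathbf{1}$ and the rule $\mathbf{1}L$. A sequent is derivable from a set of sequents $\mathcal H$ in a calculus if it is derivable when the sequents of $\mathcal H$ are added as extra axioms (Cut being allowed). *)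

(* Defs.v *)
From Stdlib Require Import List.
Import ListNotations.

Inductive formula : Set :=
| Var (n : nat)
| Zero
| One
| Prod (A B : formula)
| Under (A B : formula)  (* [A \ B] *)
| Over (B A : formula)   (* [B / A], denominator second *)
| Meet (A B : formula).

Record sequent : Set := Sequent { antecedent : list formula; succedent : formula }.

Notation "G ⊢ C" := (Sequent G C) (at level 70, no associativity).

Fixpoint product_free (A : formula) : Prop :=
  match A with
  | Var _ | Zero | One => True
  | Prod _ _ => False
  | Under A B | Over A B | Meet A B => product_free A /\ product_free B
  end.

Fixpoint constant_free (A : formula) : Prop :=
  match A with
  | Var _ => True
  | Zero | One => False
  | Prod A B | Under A B | Over A B | Meet A B => constant_free A /\ constant_free B
  end.

Definition sequent_in (lang : formula -> Prop) (s : sequent) : Prop :=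
  Forall lang (antecedent s) /\ lang (succedent s).

(* [R ps s]: [s] is inferred from the list of premises [ps] by one rule
   instance; axioms are the instances without premises. *)
Definition rules := list sequent -> sequent -> Prop.

Inductive lambek_meet_rules : rules :=
| ax_id A :
    lambek_meet_rules [] ([A] ⊢ A)
| cut G P D A C :
    lambek_meet_rules [P ⊢ A; G ++ [A] ++ D ⊢ C] (G ++ P ++ D ⊢ C)
| under_L G P D A B C :
    lambek_meet_rules [P ⊢ A; G ++ [B] ++ D ⊢ C] (G ++ P ++ [Under A B] ++ D ⊢ C)
| under_R P A B :
    lambek_meet_rules [[A] ++ P ⊢ B] (P ⊢ Under A B)
| over_L G P D A B C :
    lambek_meet_rules [P ⊢ A; G ++ [B] ++ D ⊢ C] (G ++ [Over B A] ++ P ++ D ⊢ C)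
| over_R P A B :
    lambek_meet_rules [P ++ [A] ⊢ B] (P ⊢ Over B A)
| meet_L1 G D A B C :
    lambek_meet_rules [G ++ [A] ++ D ⊢ C] (G ++ [Meet A B] ++ D ⊢ C)
| meet_L2 G D A B C :
    lambek_meet_rules [G ++ [A] ++ D ⊢ C] (G ++ [Meet B A] ++ D ⊢ C)
| meet_R P A B :
    lambek_meet_rules [P ⊢ A; P ⊢ B] (P ⊢ Meet A B).

Inductive constant_rules : rules :=
| ax_zero G D C :
    constant_rules [] (G ++ [Zero] ++ D ⊢ C)
| ax_one :
    constant_rules [] ([] ⊢ One)
| one_L G D C :
    constant_rules [G ++ D ⊢ C] (G ++ [One] ++ D ⊢ C).

Inductive product_rules : rules :=
| prod_L G D A B C :
    product_rules [G ++ [A; B] ++ D ⊢ C] (G ++ [Prod A B] ++ D ⊢ C)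
| prod_R P D A B :
    product_rules [P ⊢ A; D ⊢ B] (P ++ D ⊢ Prod A B).

(* Every sequent of the derivation, and hence every cut formula, must lie in
   the language [lang] of the calculus. *)
Inductive derivable (lang : formula -> Prop) (R : rules) (H : sequent -> Prop)
  : sequent -> Prop :=
| derivable_hyp s :
    sequent_in lang s -> H s -> derivable lang R H s
| derivable_rule ps s :
    sequent_in lang s -> R ps s ->
    (forall p, In p ps -> derivable lang R H p) ->
    derivable lang R H s.

Definition derivable_L01 : (sequent -> Prop) -> sequent -> Prop :=
  derivable (fun _ => True)
    (fun ps s => lambek_meet_rules ps s \/ constant_rules ps s \/ product_rules ps s).

Definition derivable_Lpf01 : (sequent -> Prop) -> sequent -> Prop :=
  derivable product_free
    (fun ps s => lambek_meet_rules ps s \/ constant_rules ps s).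

Definition derivable_Lpf : (sequent -> Prop) -> sequent -> Prop :=
  derivable (fun A => product_free A /\ constant_free A) lambek_meet_rules.

(* Main.v *)
Require Import Defs.
From Stdlib Require Import List.
Import ListNotations.

(** In a phase space on a free monoid, a formula denotes a set of words that is
    closed for the Galois connection between words and the tests "the word
    belongs to a given pole after insertion into a given context". The full
    calculus is sound in every phase space, a product denoting the closure of
    the pointwise concatenation. For a product-free fragment, take as words the
    lists of formulae and as poles the sets [{P | P ⊢ C is derivable in the
    fragment}]: every formula [A] of the fragment then denotes its own pole, so
    that a sequent of the fragment is valid exactly if it is derivable there. *)

Local Notation "X ⊆ Y" := (forall w, X w -> Y w) (at level 70, no associativity).

Section PhaseSemantics.

Context {T I : Type} (pole : I -> list T -> Prop).

Definition closure (X : list T -> Prop) (w : list T) : Prop :=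
  forall i g d,
    (forall u, X u -> pole i (g ++ u ++ d)) -> pole i (g ++ w ++ d).

Definition closed (X : list T -> Prop) : Prop := closure X ⊆ X.

Lemma subset_closure X : X ⊆ closure X.
Proof. intros w Xw i g d hX. auto. Qed.

Lemma closure_mono X Y : X ⊆ Y -> closure X ⊆ closure Y.
Proof. intros XY w cX i g d hY. apply cX. auto. Qed.

Lemma closure_least X Y : closed Y -> X ⊆ Y -> closure X ⊆ Y.
Proof. intros cY XY w cX. apply cY. revert w cX. now apply closure_mono. Qed.

Lemma closure_closed X : closed (closure X).
Proof. intros w cX i g d hX. apply cX. intros u cu. now apply cu. Qed.

Lemma pole_closed i : closed (pole i).
Proof.
  intros w cw. specialize (cw i [] []). simpl in cw. rewrite app_nil_r in cw.
  apply cw. intros u. now rewrite app_nil_r.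
Qed.

Lemma closed_translate Y g d : closed Y -> closed (fun w => Y (g ++ w ++ d)).
Proof.
  intros cY w cw. apply cY. intros i g' d' hY.
  specialize (cw i (g' ++ g) (d ++ d')).
  repeat rewrite <- app_assoc in *. apply cw. intros u Yu.
  specialize (hY _ Yu). now repeat rewrite <- app_assoc in *.
Qed.

Definition product (X Y : list T -> Prop) (w : list T) : Prop :=
  exists u v, w = u ++ v /\ X u /\ Y v.

Context (valuation : nat -> list T -> Prop)
  (valuation_closed : forall n, closed (valuation n)).

Fixpoint interp (A : formula) : list T -> Prop :=
  match A with
  | Var n => valuation n
  | Zero => closure (fun _ => False)
  | One => closure (eq [])
  | Prod A B => closure (product (interp A) (interp B))
  | Under A B => fun w => forall u, interp A u -> interp B (u ++ w)
  | Over B A => fun w => forall u, interp A u -> interp B (w ++ u)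
  | Meet A B => fun w => interp A w /\ interp B w
  end.

Lemma interp_closed A : closed (interp A).
Proof.
  induction A as [n | | | A _ B _ | A _ B IHB | B IHB A _ | A IHA B IHB];
    try apply closure_closed; simpl.
  - apply valuation_closed.
  - intros w cw u Au. rewrite <- (app_nil_r w).
    revert w cw. apply closure_least; [now apply closed_translate |].
    intros v hv. rewrite app_nil_r. auto.
  - intros w cw u Au.
    revert w cw. apply closure_least; [now apply (closed_translate _ [] u) | auto].
  - intros w cw. split; revert w cw; apply closure_least; tauto.
Qed.

Fixpoint interp_list (L : list formula) : list T -> Prop :=
  match L with
  | [] => eq []
  | A :: L => product (interp A) (interp_list L)
  end.

Lemma interp_list_singleton A w : interp_list [A] w <-> interp A w.
Proof.
  split.
  - intros (u & v & -> & h & <-). now rewrite app_nil_r.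
  - intros h. exists w, []. now rewrite app_nil_r.
Qed.

Lemma interp_list_app L1 L2 w :
  interp_list (L1 ++ L2) w <-> product (interp_list L1) (interp_list L2) w.
Proof.
  revert w; induction L1 as [| A L1 IH]; intros w; simpl; split.
  - intros h. now exists [], w.
  - now intros (u & v & -> & <- & h).
  - intros (a & r & -> & ha & hr). apply IH in hr as (u & v & -> & hu & hv).
    exists (a ++ u), v. rewrite <- app_assoc. repeat split; trivial.
    now exists a, u.
  - intros (r & v & -> & (a & u & -> & ha & hu) & hv).
    exists a, (u ++ v). rewrite <- app_assoc. repeat split; trivial.
    apply IH. now exists u, v.
Qed.

Definition valid (s : sequent) : Prop :=
  interp_list (antecedent s) ⊆ interp (succedent s).

Lemma valid_middle G L D C :
  valid (G ++ L ++ D ⊢ C) <->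
  forall g d, interp_list G g -> interp_list D d ->
    interp_list L ⊆ (fun w => interp C (g ++ w ++ d)).
Proof.
  unfold valid; simpl. split.
  - intros v g d hg hd w hw. apply v, interp_list_app.
    exists g, (w ++ d). repeat split; trivial.
    apply interp_list_app. now exists w, d.
  - intros v w h.
    apply interp_list_app in h as (g & r & -> & hg & hr).
    apply interp_list_app in hr as (u & d & -> & hu & hd). auto.
Qed.

Lemma valid_replace G L L' D C :
  interp_list L' ⊆ closure (interp_list L) ->
  valid (G ++ L ++ D ⊢ C) -> valid (G ++ L' ++ D ⊢ C).
Proof.
  rewrite !valid_middle. intros hL v g d hg hd w hw.
  apply hL in hw. revert w hw.
  apply closure_least; [apply closed_translate, interp_closed | now apply v].
Qed.

Lemma valid_replace_formula G L A D C :
  interp_list L ⊆ interp A ->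
  valid (G ++ [A] ++ D ⊢ C) -> valid (G ++ L ++ D ⊢ C).
Proof.
  intros hL. apply valid_replace. intros w hw.
  apply subset_closure, interp_list_singleton. auto.
Qed.

Lemma interp_list_under L A B :
  interp_list L ⊆ interp A -> interp_list (L ++ [Under A B]) ⊆ interp B.
Proof.
  intros hL w h. apply interp_list_app in h as (u & v & -> & hu & hv).
  apply interp_list_singleton in hv. simpl in hv. auto.
Qed.

Lemma interp_list_over L A B :
  interp_list L ⊆ interp A -> interp_list ([Over B A] ++ L) ⊆ interp B.
Proof.
  intros hL w h. apply interp_list_app in h as (v & u & -> & hv & hu).
  apply interp_list_singleton in hv. simpl in hv. auto.
Qed.

Lemma lambek_meet_rules_sound ps s :
  lambek_meet_rules ps s -> Forall valid ps -> valid s.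
Proof.
  intros r vps.
  destruct r as [A | G P D A C | G P D A B C | P A B | G P D A B C | P A B
                | G D A B C | G D A B C | P A B];
    repeat rewrite Forall_cons_iff in vps.
  - intros w. apply interp_list_singleton.
  - destruct vps as (vA & vC & _). now apply valid_replace_formula with A.
  - destruct vps as (vA & vC & _). rewrite (app_assoc P).
    apply valid_replace_formula with B; trivial. now apply interp_list_under.
  - destruct vps as (vB & _). intros w hw u hu. apply vB. now exists u, w.
  - destruct vps as (vA & vC & _). rewrite (app_assoc [Over B A]).
    apply valid_replace_formula with B; trivial. now apply interp_list_over.
  - destruct vps as (vB & _). intros w hw u hu. apply vB, interp_list_app.
    exists w, u. now rewrite interp_list_singleton.
  - destruct vps as (vC & _). apply valid_replace_formula with A; trivial.
    intros w hw. now apply interp_list_singleton in hw as [hA _].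
  - destruct vps as (vC & _). apply valid_replace_formula with A; trivial.
    intros w hw. now apply interp_list_singleton in hw as [_ hA].
  - destruct vps as (vA & vB & _). intros w hw. split; auto.
Qed.

Lemma constant_rules_sound ps s :
  constant_rules ps s -> Forall valid ps -> valid s.
Proof.
  intros r vps. destruct r as [G D C | | G D C].
  - apply valid_middle. intros g d _ _ w hw. apply interp_list_singleton in hw.
    revert w hw.
    apply closure_least; [apply closed_translate, interp_closed | contradiction].
  - exact (subset_closure (eq [])).
  - rewrite Forall_cons_iff in vps. destruct vps as (vC & _).
    apply valid_replace with []; trivial.
    intros w. apply interp_list_singleton.
Qed.

Lemma product_rules_sound ps s :
  product_rules ps s -> Forall valid ps -> valid s.
Proof.
  intros r vps. destruct r as [G D A B C | P D A B];
    repeat rewrite Forall_cons_iff in vps.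
  - destruct vps as (vC & _). apply valid_replace with [A; B]; trivial.
    intros w hw. apply interp_list_singleton in hw.
    revert w hw. apply closure_mono. intros w (u & v & -> & hu & hv).
    exists u, v. now rewrite interp_list_singleton.
  - destruct vps as (vA & vB & _). intros w hw.
    apply interp_list_app in hw as (u & v & -> & hu & hv).
    apply subset_closure. exists u, v.
    repeat split; [apply vA | apply vB]; trivial.
Qed.

Lemma derivable_L01_sound H s : H ⊆ valid -> derivable_L01 H s -> valid s.
Proof.
  intros vH. induction 1 as [s _ Hs | ps s _ r _ IH]; [now apply vH |].
  apply Forall_forall in IH. destruct r as [r | [r | r]].
  - now apply lambek_meet_rules_sound with ps.
  - now apply constant_rules_sound with ps.
  - now apply product_rules_sound with ps.
Qed.

End PhaseSemantics.

Record product_free_fragment (lang : formula -> Prop) (R : rules) : Prop := {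
  not_lang_Prod A B : ~ lang (Prod A B);
  lang_Under_inv A B : lang (Under A B) -> lang A /\ lang B;
  lang_Over_inv A B : lang (Over B A) -> lang B /\ lang A;
  lang_Meet_inv A B : lang (Meet A B) -> lang A /\ lang B;
  rules_complete ps s :
    sequent_in lang s -> lambek_meet_rules ps s \/ constant_rules ps s -> R ps s
}.

Section CanonicalModel.

Context (lang : formula -> Prop) (R : rules) (H : sequent -> Prop)
  (fragment : product_free_fragment lang R).

(* Sequents outside the language count as provable: the words of the model can
   then be all lists of formulae, without a side condition on contexts. *)
Definition provable (s : sequent) : Prop :=
  sequent_in lang s -> derivable lang R H s.

Lemma provable_rule ps s :
  lambek_meet_rules ps s \/ constant_rules ps s ->
  (sequent_in lang s -> Forall (sequent_in lang) ps) ->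
  Forall provable ps -> provable s.
Proof.
  intros r lps dps ls. apply derivable_rule with ps; trivial.
  - now apply (rules_complete _ _ fragment).
  - specialize (lps ls). rewrite Forall_forall in lps, dps.
    intros p hp. now apply dps, lps.
Qed.

Local Ltac solve_in_lang :=
  unfold sequent_in; rewrite ?Forall_cons_iff; simpl;
  rewrite ?Forall_app, ?Forall_cons_iff; intuition.

Lemma provable_id A : provable ([A] ⊢ A).
Proof. apply provable_rule with []; auto using ax_id. Qed.

Lemma provable_cut G P D A C :
  lang A -> provable (P ⊢ A) -> provable (G ++ [A] ++ D ⊢ C) ->
  provable (G ++ P ++ D ⊢ C).
Proof.
  intros lA dA dC. apply provable_rule with [P ⊢ A; G ++ [A] ++ D ⊢ C]; auto.
  - left. apply cut.
  - solve_in_lang.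
Qed.

Lemma provable_Under A B P :
  lang (Under A B) ->
  provable (P ⊢ Under A B) <->
  forall Q, provable (Q ⊢ A) -> provable (Q ++ P ⊢ B).
Proof.
  intros lAB. destruct (lang_Under_inv _ _ fragment _ _ lAB) as [lA lB]. split.
  - intros dAB Q dA. rewrite <- (app_nil_r P).
    apply provable_cut with (Under A B); trivial.
    apply provable_rule with [Q ⊢ A; [B] ⊢ B]; auto using provable_id.
    + left. apply (under_L [] Q [] A B B).
    + solve_in_lang.
  - intros h. apply provable_rule with [[A] ++ P ⊢ B]; auto using provable_id.
    + left. apply under_R.
    + solve_in_lang.
Qed.

Lemma provable_Over A B P :
  lang (Over B A) ->
  provable (P ⊢ Over B A) <->
  forall Q, provable (Q ⊢ A) -> provable (P ++ Q ⊢ B).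
Proof.
  intros lBA. destruct (lang_Over_inv _ _ fragment _ _ lBA) as [lB lA]. split.
  - intros dBA Q dA. apply (provable_cut [] P Q (Over B A)); trivial.
    apply provable_rule with [Q ⊢ A; [B] ⊢ B]; auto using provable_id.
    + left. rewrite <- (app_nil_r Q) at 2. apply (over_L [] Q [] A B B).
    + solve_in_lang.
  - intros h. apply provable_rule with [P ++ [A] ⊢ B]; auto using provable_id.
    + left. apply over_R.
    + solve_in_lang.
Qed.

Lemma provable_Meet A B P :
  lang (Meet A B) ->
  provable (P ⊢ Meet A B) <-> provable (P ⊢ A) /\ provable (P ⊢ B).
Proof.
  intros lAB. destruct (lang_Meet_inv _ _ fragment _ _ lAB) as [lA lB]. split.
  - intros dAB. rewrite <- (app_nil_r P).
    split; apply (provable_cut [] P [] (Meet A B)); trivial.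
    + apply provable_rule with [[A] ⊢ A]; auto using provable_id.
      * left. apply (meet_L1 [] []).
      * solve_in_lang.
    + apply provable_rule with [[B] ⊢ B]; auto using provable_id.
      * left. apply (meet_L2 [] []).
      * solve_in_lang.
  - intros [dA dB]. apply provable_rule with [P ⊢ A; P ⊢ B]; auto.
    + left. apply meet_R.
    + solve_in_lang.
Qed.

Local Notation pole := (fun C P => provable (P ⊢ C)).
Local Notation canonical_interp := (interp pole (fun n => pole (Var n))).
Local Notation canonical_interp_list :=
  (interp_list pole (fun n => pole (Var n))).
Local Notation canonical_valid := (valid pole (fun n => pole (Var n))).

Lemma provable_Zero P :
  lang Zero -> provable (P ⊢ Zero) <-> closure pole (fun _ => False) P.
Proof.
  intros l0. split.
  - intros d0 C G D _. apply provable_cut with Zero; trivial.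
    apply provable_rule with []; auto using ax_zero.
  - revert P. apply closure_least; [apply (pole_closed pole) | contradiction].
Qed.

Lemma provable_One P :
  lang One -> provable (P ⊢ One) <-> closure pole (eq []) P.
Proof.
  intros l1. split.
  - intros d1 C G D h. apply provable_cut with One; trivial.
    apply provable_rule with [G ++ D ⊢ C].
    + right. apply one_L.
    + solve_in_lang.
    + constructor; [exact (h [] eq_refl) | constructor].
  - revert P. apply closure_least; [apply (pole_closed pole) |].
    intros P <-. apply provable_rule with []; auto using ax_one.
Qed.

Lemma canonical_interp_iff A P :
  lang A -> canonical_interp A P <-> provable (P ⊢ A).
Proof.
  revert P;
    induction A as [n | | | A _ B _ | A IHA B IHB | B IHB A IHA | A IHA B IHB];
    intros P lA; simpl.
  - reflexivity.
  - symmetry. now apply provable_Zero.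
  - symmetry. now apply provable_One.
  - now destruct (not_lang_Prod _ _ fragment A B).
  - rewrite provable_Under by trivial. apply (lang_Under_inv _ _ fragment) in lA.
    now split; intros h Q hQ; apply IHB, h, IHA.
  - rewrite provable_Over by trivial. apply (lang_Over_inv _ _ fragment) in lA.
    now split; intros h Q hQ; apply IHB, h, IHA.
  - rewrite provable_Meet by trivial. apply (lang_Meet_inv _ _ fragment) in lA.
    rewrite IHA, IHB by tauto. reflexivity.
Qed.

Lemma canonical_interp_list_refl L : Forall lang L -> canonical_interp_list L L.
Proof.
  induction 1 as [| A L lA _ IH]; simpl; trivial.
  exists [A], L. repeat split; trivial.
  apply canonical_interp_iff; auto using provable_id.
Qed.

Lemma provable_cut_list G L P C :
  Forall lang L -> canonical_interp_list L P ->
  provable (G ++ L ⊢ C) -> provable (G ++ P ⊢ C).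
Proof.
  intros lL. revert G P. induction lL as [| A L lA _ IH]; intros G P; simpl.
  - now intros <-.
  - intros (Q & Q' & -> & hQ & hQ') d. apply canonical_interp_iff in hQ; trivial.
    rewrite app_assoc. apply IH; trivial. rewrite <- app_assoc.
    now apply provable_cut with A.
Qed.

Lemma canonical_valid_iff s :
  sequent_in lang s -> canonical_valid s <-> derivable lang R H s.
Proof.
  destruct s as [L C]. intros [lL lC]. split.
  - intros v. apply (canonical_interp_iff C L lC); [| now split].
    now apply v, canonical_interp_list_refl.
  - intros d P hP. apply canonical_interp_iff; trivial.
    now apply (provable_cut_list [] L).
Qed.

Lemma derivable_L01_conservative s :
  H ⊆ sequent_in lang -> sequent_in lang s ->
  derivable_L01 H s -> derivable lang R H s.
Proof.
  intros lH ls d. apply canonical_valid_iff; trivial.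
  apply derivable_L01_sound with H; trivial.
  - intros n. apply (pole_closed pole).
  - intros p Hp. apply canonical_valid_iff; auto using derivable_hyp.
Qed.

End CanonicalModel.

Lemma Lpf01_fragment :
  product_free_fragment product_free
    (fun ps s => lambek_meet_rules ps s \/ constant_rules ps s).
Proof. split; simpl; auto. Qed.

Lemma constant_rules_not_constant_free ps s :
  constant_rules ps s -> ~ sequent_in constant_free s.
Proof.
  intros r [lG lC]. destruct r; simpl in *;
    rewrite ?Forall_app, ?Forall_cons_iff in lG; tauto.
Qed.

Lemma sequent_in_and lang1 lang2 s :
  sequent_in (fun A => lang1 A /\ lang2 A) s <->
  sequent_in lang1 s /\ sequent_in lang2 s.
Proof.
  split.
  - intros [lL [l1 l2]]. apply Forall_and_inv in lL as [l1L l2L]. now repeat split.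
  - intros [[l1L l1] [l2L l2]]. repeat split; auto using Forall_and.
Qed.

Lemma Lpf_fragment :
  product_free_fragment (fun A => product_free A /\ constant_free A)
    lambek_meet_rules.
Proof.
  split; simpl; try tauto.
  intros ps s ls [r | r]; trivial.
  apply sequent_in_and in ls as [_ ls].
  now apply constant_rules_not_constant_free in r.
Qed.

Theorem theorem6p1 (H : sequent -> Prop) (P : list formula) (B : formula)
  (H_pf : forall s, H s -> sequent_in product_free s)
  (s_pf : sequent_in product_free (P ⊢ B))
  (der : derivable_L01 H (P ⊢ B)) :
  derivable_Lpf01 H (P ⊢ B) /\
  ((forall s, H s -> sequent_in constant_free s) ->
   sequent_in constant_free (P ⊢ B) ->
   derivable_Lpf H (P ⊢ B)).
Proof.
  split.
  - now apply (derivable_L01_conservative _ _ _ Lpf01_fragment).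
  - intros H_cf s_cf. apply (derivable_L01_conservative _ _ _ Lpf_fragment); trivial.
    + intros s Hs. apply sequent_in_and. auto.
    + now apply sequent_in_and.
Qed.
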